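(* Let $(\rho,\sigma)\in\mathfrak V$ with $\sigma\le0$ and let $C,D\in W^{(l)}\setminus\{0\}$ with $v_{\rho,\sigma}(C)>0$. If $[C^k,D]_{\rho,\sigma}=\ell_{\rho,\sigma}(C^{k+j})$ for some $k\in\mathbb{N}$ and $j\in\mathbb{N}_0$, then there exists a $(\rho,\sigma)$-homogeneous element $E\in W^{(l)}$ such that $[C^t,E]_{\rho,\sigma}=t\,\ell_{\rho,\sigma}(C^t)$ for all $t\in\mathbb{N}$.
   Context: $K$ is a field of characteristic zero, $l\in\mathbb{N}$. $W^{(l)}$ is the associative $K$-algebra with $K$-basis $\{X^{i/l}Y^j:i\in\mathbb{Z},j\in\mathbb{N}_0\}$, powers of $X$ multiplying as Laurent monomials and $[Y,X^{\alpha}]=\alpha X^{\alpha-1}$ for $\alpha\in\frac1l\mathbb{Z}$. $L^{(l)}=K[x^{1/l},x^{-1/l},y]$, $\Psi^{(l)}(X^{i/l}Y^j)=x^{i/l}y^j$ ($K$-linear); $\mathrm{Supp}(P)$ = set of exponents of $\Psi^{(l)}(P)$ with nonzero coefficient. $\mathfrak V=\{(\rho,\sigma)\in\mathbb{Z}^2:\gcd(\rho,\sigma)=1,\rho+\sigma>0\}$. For $P\ne0$: $v_{\rho,\sigma}(P)=\max\{\rho a+\sigma b:(a,b)\in\mathrm{Supp}(P)\}$; $\ell_{\rho,\sigma}(P)\in L^{(l)}$ is the sum of the terms of $\Psi^{(l)}(P)$ of $(\rho,\sigma)$-degree $v_{\rho,\sigma}(P)$. $P$ is $(\rho,\sigma)$-homogeneous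 if $P=0$ or $\Psi^{(l)}(P)=\ell_{\rho,\sigma}(P)$. $[P,Q]_{\rho,\sigma}:=0$ if $[P,Q]=0$ or $v_{\rho,\sigma}([P,Q])<v_{\rho,\sigma}(P)+v_{\rho,\sigma}(Q)-(\rho+\sigma)$, and $:=\ell_{\rho,\sigma}([P,Q])$ otherwise. *)

(* Defs.v *)
From HB Require Import structures.
From mathcomp Require Import all_boot all_order all_algebra.
From mathcomp Require Import finmap.
From mathcomp Require Export monalg.
Set Implicit Arguments. Unset Strict Implicit. Unset Printing Implicit Defensive.
Import Order.TTheory GRing.Theory Num.Theory.
Local Open Scope ring_scope.

(* Exponent (i, j) : int * nat encodes the basis monomial X^(i/l) Y^j of W^(l)
   (resp. x^(i/l) y^j of L^(l)). *)
Definition expo := (int * nat)%type.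

(* Underlying K-vector space of W^(l) (and of L^(l)): finitely supported
   functions expo -> K, i.e. K-linear combinations of basis monomials. *)
Definition W (K : fieldType) := {malg K[expo]}.

(* L^(l) = K[x^(1/l), x^(-1/l), y] has the same K-basis; Psi^(l) is the
   K-linear map sending X^(i/l)Y^j to x^(i/l)y^j, i.e. the identity on
   coefficient functions. *)
Definition L (K : fieldType) := W K.
Definition Psi (K : fieldType) (P : W K) : L K := P.

Definition ffact (K : fieldType) (b : K) (m : nat) : K :=
  \prod_(k < m) (b - k%:R).

Definition frac (K : fieldType) (l : nat) (i : int) : K := i%:~R / l%:R.

(* product of basis monomials in W^(l):
   X^a Y^j1 * X^b Y^j2 = sum_m C(j1,m) b(b-1)..(b-m+1) X^(a+b-m) Y^(j1+j2-m),
   from [Y, X^b] = b X^(b-1) (Leibniz rule). Here a = i1/l, b = i2/l. *)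
Definition monmul (K : fieldType) (l : nat) (e1 e2 : expo) : W K :=
  \sum_(m < e1.2.+1)
     << ('C(e1.2, m)%:R * ffact (frac K l e2.1) m)
        *g (e1.1 + e2.1 - (m * l)%:Z, (e1.2 + e2.2 - m)%N) >>.

Definition mulW (K : fieldType) (l : nat) (P Q : W K) : W K :=
  \sum_(a <- msupp P) \sum_(b <- msupp Q) (P@_a * Q@_b) *: monmul K l a b.

Definition oneW (K : fieldType) : W K := << ((0:int), 0%N) >>.

Definition expW (K : fieldType) (l : nat) (P : W K) (n : nat) : W K :=
  iter n (mulW l P) (oneW K).

Definition commW (K : fieldType) (l : nat) (P Q : W K) : W K :=
  mulW l P Q - mulW l Q P.

Definition degE (l : nat) (rho sigma : int) (e : expo) : rat :=
  rho%:~R * (e.1%:~R / l%:R) + sigma%:~R * e.2%:R.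

(* v_{rho,sigma}(P): maximum of the degrees over Supp(P) (meaningful for P<>0) *)
Definition vdeg (K : fieldType) (l : nat) (rho sigma : int) (P : W K) : rat :=
  \big[Num.max/degE l rho sigma (head (0, 0%N) (msupp P))]_(a <- msupp P)
     degE l rho sigma a.

Definition ell (K : fieldType) (l : nat) (rho sigma : int) (P : W K) : L K :=
  \sum_(a <- msupp (Psi P) | degE l rho sigma a == vdeg l rho sigma P)
     << (Psi P)@_a *g a >>.

Definition homogeneous (K : fieldType) (l : nat) (rho sigma : int) (P : W K) :=
  P = 0 \/ Psi P = ell l rho sigma P.

Definition commRS (K : fieldType) (l : nat) (rho sigma : int) (P Q : W K) : L K :=
  let R := commW l P Q in
  if (R == 0) || (vdeg l rho sigma R <
                  vdeg l rho sigma P + vdeg l rho sigma Q - (rho + sigma)%:~R)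
  then 0 else ell l rho sigma R.

Definition inV (rho sigma : int) := coprimez rho sigma /\ (0 < rho + sigma)%R.

(* Main.v *)
(* Putting x = 1 turns the component of degree d (scaled by l) of an element
   of W^(l) into a polynomial in y (its symbol) from which it can be recovered.
   Since rho + sigma > 0, top symbols are multiplicative, and the top symbol of
   [P, Q] is the Poisson bracket, which for symbols f, g of degrees p, q is
   proportional to q f' g - p f g'. The hypothesis becomes
     (j v + w) f' g - v f g' = c f^(j+1),   w = l (rho + sigma) > 0,  v > 0,
   and looking at the multiplicities at each irreducible polynomial gives f^j | g.
   The quotient h satisfies w f' h - v f h' = c f, and a multiple of it is the
   symbol of E. *)

Require Import Defs.
From HB Require Import structures.
From mathcomp Require Import all_boot all_order all_algebra.
From mathcomp Require Import finmap.
From mathcomp Require Import monalg.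
From mathcomp Require Import ring zify.
Set Implicit Arguments. Unset Strict Implicit. Unset Printing Implicit Defensive.
Import Order.TTheory GRing.Theory Num.Theory.
Local Open Scope ring_scope.

(** * Irreducible factors and multiplicities of polynomials *)

(** By strong induction, divisors of [s] of smaller size are constant, so a nonconstant [s] would be
    irreducible and divide itself. *)
Lemma no_irredp_dvd (F : fieldType) (s : {poly F}) :
  (forall p, irreducible_poly p -> ~~ (p %| s)) -> (size s <= 1)%N.
Proof.
elim: {s}(size s) {-2}s (leqnn (size s)) => [|n IH] s sn Hs.
  by rewrite (leq_trans sn).
rewrite leqNgt; apply/negP => s1.
have s0 : s != 0 by rewrite -size_poly_gt0 (leq_trans _ s1).
suff irr : irreducible_poly s by move: (Hs s irr); rewrite dvdpp.
split=> // q q1 qs; rewrite -dvdp_size_eqp //; apply/negPn/negP => qns.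
have ltq : (size q < size s)%N by rewrite ltn_neqAle qns dvdp_leq.
have q0 : q != 0 by apply: contraTneq qs => ->; rewrite dvd0p.
have := IH q (leq_trans ltq sn) (fun p ip => contra (fun h => dvdp_trans h qs) (Hs p ip)).
by move: q1; rewrite -size_poly_gt0 in q0; case: (size q) q0 => [|[|]].
Qed.

Lemma dvdp_multiplicity (F : fieldType) (p f : {poly F}) :
  irreducible_poly p -> f != 0 ->
  exists m u, f = p ^+ m * u /\ ~~ (p %| u).
Proof.
move=> ip; have [p1 _] := ip.
elim: {f}(size f) {-2}f (leqnn (size f)) => [|n IH] f sn f0.
  by move: sn; rewrite leqn0 size_poly_eq0 (negPf f0).
have [/dvdpP [q fE]|pf] := boolP (p %| f); last first.
  by exists 0%N, f; rewrite expr0 mul1r.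
have q0 : q != 0 by apply: contraNneq f0; rewrite fE => ->; rewrite mul0r.
have [|m [u [qE pu]]] := IH q _ q0.
  have sf := size_mul q0 (irredp_neq0 ip); rewrite -fE in sf.
  have aux (a b : nat) : ((a + b).-1 <= n.+1 -> 1 < b -> a <= n)%N by lia.
  by rewrite sf in sn; exact: aux sn p1.
by exists m.+1, u; split=> //; rewrite fE qE exprS; ring.
Qed.

(** The factor [p] on the left avoids the exponent [m - 1], so that [m = 0] fits the same
    formula. *)
Lemma mul_derivX (F : fieldType) (p : {poly F}) m :
  p * (p ^+ m)^`() = m%:R%:P * p^`() * p ^+ m.
Proof.
rewrite deriv_exp; case: m => [|m] /=; first by rewrite mulr0n !mul0r mulr0.
by rewrite -mulr_natl exprS polyCMn; ring.
Qed.

Lemma irredp_mul_dvd (F : fieldType) (p f g : {poly F}) :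
  irreducible_poly p -> (p %| f * g) = (p %| f) || (p %| g).
Proof.
move=> ip; have [pf|pf] := boolP (p %| f); first by rewrite dvdp_mulr.
by rewrite Gauss_dvdpr // irreducible_poly_coprime.
Qed.

Lemma irredp_exp_dvd (F : fieldType) (p u : {poly F}) n :
  irreducible_poly p -> ~~ (p %| u) -> ~~ (p %| u ^+ n).
Proof.
move=> ip pu; elim: n => [|n IH]; last by rewrite exprS irredp_mul_dvd // negb_or pu.
by rewrite expr0 dvdp1; case: ip => p1 _; rewrite gtn_eqF.
Qed.

(** * Divisibility by [f ^+ j] from the bracket equation *)

Section CharZero.
Variables (F : fieldType) (F0 : [pchar F] =i pred0).

Lemma pchar0_intr_eq0 (z : int) : (z%:~R == 0 :> F) = (z == 0).
Proof.
have nat0 n : (n%:R == 0 :> F) = (n == 0%N) by rewrite ((pcharf0P F).1 F0).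
by case: z => n; rewrite ?NegzE ?mulrNz ?oppr_eq0 -pmulrn nat0.
Qed.

(** In characteristic zero the derivative of a nonconstant polynomial is nonzero, and its size is
    too small for a multiple of [p]. *)
Lemma irredp_ndvd_deriv (p : {poly F}) : irreducible_poly p -> ~~ (p %| p^`()).
Proof.
case=> p1 _; have p0 : p != 0 by rewrite -size_poly_gt0 (leq_trans _ p1).
suff p'0 : p^`() != 0 by apply/negP => /(dvdp_leq p'0); rewrite leqNgt lt_size_deriv.
apply/negP => /eqP/polyP/(_ (size p).-2).
rewrite coef_deriv coef0 -mulr_natr => /eqP; rewrite mulf_eq0.
have -> : (size p).-2.+1 = (size p).-1 by case: (size p) p1 => [|[]].
rewrite -lead_coefE lead_coef_eq0 (negPf p0) /=.
by rewrite ((pcharf0P F).1 F0); case: (size p) p1 => [|[]].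
Qed.

(* At an irreducible p with multiplicities m in f and n in g, the left-hand side
   has the factor p with multiplicity exactly m + n - 1 unless
   (j v + w) m = v n, and this forces n > j m. *)
Lemma bracket_eq_expr_dvd (f g : {poly F}) (v w : int) (lam : F) (j : nat) :
  0 < v -> 0 < w -> f != 0 ->
  (j%:Z * v + w)%:~R%:P * f^`() * g - v%:~R%:P * f * g^`() = lam%:P * f ^+ j.+1 ->
  f ^+ j %| g.
Proof.
move=> v0 w0 f0 eqn.
have [->|g0] := eqVneq g 0; first by rewrite dvdp0.
have fj0 : f ^+ j != 0 by rewrite expf_neq0.
(* Dividing [f ^+ j] and [g] by their gcd [q] leaves coprime [s] and [h]. The goal becomes that [s]
   is constant, so an irreducible factor [p] of [s] is to be refuted. *)
set q := gcdp (f ^+ j) g.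
have q0 : q != 0 by rewrite gcdp_eq0 negb_and g0 orbT.
have /dvdpP [s fE] : q %| f ^+ j := dvdp_gcdl _ _.
have /dvdpP [h gE] : q %| g := dvdp_gcdr _ _.
have cop : coprimep s h.
  have : gcdp (s * q) (h * q) %= q by rewrite -fE -gE eqpxx.
  move/(eqp_trans (mulp_gcdl s h q))/eqp_size; rewrite /coprimep.
  have [->|gn] := eqVneq (gcdp s h) 0.
    by rewrite mul0r size_poly0 => /esym/eqP; rewrite size_poly_eq0 (negPf q0).
  rewrite size_mul //; rewrite -!size_poly_gt0 in gn q0.
  by move: (size q) q0 (size _) gn => [//|b] _ a _; lia.
suff s1 : (size s <= 1)%N.
  have s0 : s != 0 by apply: contraNneq fj0; rewrite fE => ->; rewrite mul0r.
  have /eqP/size_poly1P[c c0 sE] : size s = 1%N.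
    by apply/eqP; rewrite eqn_leq s1 size_poly_gt0.
  rewrite fE sE mul_polyC (eqp_dvdl _ (eqp_scale _ c0)) gE; exact: dvdp_mulIr.
apply: no_irredp_dvd => p ip; apply/negP => ps.
have ph : ~~ (p %| h).
  apply: contraTN cop => ph; apply/coprimepPn.
    by apply: contraNneq fj0; rewrite fE => ->; rewrite mul0r.
  exists p; rewrite dvdp_gcd ps ph /= -size_poly_eq1.
  by case: ip => p1 _; rewrite gtn_eqF.
have [t [r [qE pr]]] := dvdp_multiplicity ip q0.
have [m [u [fm pu]]] := dvdp_multiplicity ip f0.
have p0 := irredp_neq0 ip.
(* Since [p] divides [s], its multiplicity [t] in [q] is below its multiplicity [j * m] in [f ^+ j].
   Since [p] does not divide [h], [t] is also its multiplicity in [g]. *)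
have lt_t : (t < j * m)%N.
  rewrite ltnNge; apply/negP => le.
  suff : p %| u ^+ j by apply/negP/irredp_exp_dvd.
  have := fE; rewrite fm exprMn -exprM mulnC qE -(subnKC le) exprD => /eqP.
  have -> : s * (p ^+ (j * m) * p ^+ (t - j * m) * r) =
      p ^+ (j * m) * (s * p ^+ (t - j * m) * r) by ring.
  rewrite (inj_eq (mulfI _)) ?expf_neq0 // => /eqP ->.
  by rewrite -mulrA dvdp_mulr.
set wt := h * r.
have pw : ~~ (p %| wt) by rewrite irredp_mul_dvd // negb_or ph.
have gt : g = p ^+ t * wt by rewrite gE qE /wt; ring.
clearbody wt.
(* The coefficient of the lowest power of [p] on the left. It equals [w m + v (j m - t)], where both
   terms are positive. *)
pose c : int := (j%:Z * v + w) * m%:Z - v * t%:Z.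
have c0 : c != 0.
  rewrite /c; have : 0 < w * m%:Z by rewrite mulr_gt0 //; lia.
  have : 0 < v * (j%:Z * m%:Z - t%:Z) by rewrite mulr_gt0 //; lia.
  nia.
(* The equation is multiplied by [p] to clear the exponent [m + t - 1]. The right side then has more
   than [m + t] factors [p], so after cancellation [p] must divide the term with [c]. *)
have E1 : p ^+ (m + t) * (c%:~R%:P * (p^`() * (u * wt)) + p *
    ((j%:Z * v + w)%:~R%:P * u^`() * wt - v%:~R%:P * u * wt^`())) =
  p ^+ (m + t) * (p * (p * p ^+ (j * m - t.+1) * lam%:P * u ^+ j.+1)).
  transitivity (p * (lam%:P * f ^+ j.+1)).
    rewrite -eqn [in RHS]gt [in RHS]fm !derivM /c.
    rewrite intrB !(intrM _ _ m) !(intrM _ v t) -!pmulrn polyCB !polyCM.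
    have := mul_derivX p m; have := mul_derivX p t.
    rewrite exprD; move: (p ^+ m)^`() (p ^+ t)^`() => dm dt Ht Hm.
    transitivity ((j%:Z * v + w)%:~R%:P * ((p * dm) * u + p * p ^+ m * u^`()) * (p ^+ t * wt) -
       v%:~R%:P * (p ^+ m * u) * ((p * dt) * wt + p * p ^+ t * wt^`())); last by ring.
    by rewrite Hm Ht; ring.
  rewrite fm exprMn -exprM.
  have -> : (m * j.+1 = m + t + (j * m - t.+1).+1)%N by nia.
  rewrite exprD exprS; ring.
move/(mulfI (expf_neq0 _ p0)): E1 => E1.
have : p %| c%:~R%:P * (p^`() * (u * wt)).
  by rewrite (canRL (addrK _) E1) -mulrBr dvdp_mulIl.
rewrite mul_polyC dvdpZr ?pchar0_intr_eq0 //.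
by rewrite !irredp_mul_dvd // (negPf pu) (negPf pw) (negPf (irredp_ndvd_deriv ip)).
Qed.
End CharZero.

(** * Degrees, components and symbols *)

Section Symbols.
Variables (K : fieldType) (l : nat) (rho sigma : int).
Hypotheses (Hl : (0 < l)%N) (Hrho : 0 < rho).

(* l times the (rho, sigma)-degree, so that it is an integer. *)
Definition degZ (e : expo) : int := rho * e.1 + sigma * l%:Z * e.2%:Z.

(** A bound instead of the exact degree: it also holds for [P = 0] and survives cancellation.
    Together with [symbol d P != 0] it pins the degree down. *)
Definition degle (P : W K) (d : int) := forall a, d < degZ a -> P@_a = 0.

(* The component of degree d of P, evaluated at x = 1: no information is lost
   because d and the y-exponent determine the x-exponent. *)
Definition symbol (d : int) (P : W K) : {poly K} :=
  mmap (@polyC K) (fun a : expo => if degZ a == d then 'X^(a.2) else 0) P.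

(** The loss in [degZ] when one [Y] differentiates a power of [X]: the exponents of both drop by
    one. *)
Definition wgt : int := l%:Z * (rho + sigma).

Lemma degE_degZ e : degE l rho sigma e = (degZ e)%:~R / l%:R.
Proof.
have l0 : l%:R != 0 :> rat by rewrite pnatr_eq0 -lt0n.
rewrite /degE /degZ intrD !intrM -!pmulrn; field.
exact: l0.
Qed.

Lemma degZ_inj (a b : expo) : degZ a = degZ b -> a.2 = b.2 -> a = b.
Proof.
case: a b => [a1 a2] [b1 b2] /= dE e2; rewrite {}e2 in dE *; congr pair.
by move/addIr: dE; apply: mulfI; rewrite gt_eqF.
Qed.

Lemma symbolD d P Q : symbol d (P + Q) = symbol d P + symbol d Q.
Proof. exact: raddfD. Qed.

Lemma symbolB d P Q : symbol d (P - Q) = symbol d P - symbol d Q.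
Proof. exact: raddfB. Qed.

Lemma symbol_sum d I (r : seq I) (p : pred I) (G : I -> W K) :
  symbol d (\sum_(i <- r | p i) G i) = \sum_(i <- r | p i) symbol d (G i).
Proof. exact: raddf_sum. Qed.

Lemma symbolU d c a :
  symbol d << c *g a >> = c%:P * (if degZ a == d then 'X^(a.2) else 0).
Proof. exact: mmapU. Qed.

Lemma symbolZ d c P : symbol d (c *: P) = c%:P * symbol d P.
Proof.
rewrite /symbol (mmapEw (msuppZ_le _ _)) mmapE big_distrr /=.
by apply/eq_bigr=> a _; rewrite mcoeffZ polyCM mulrA.
Qed.

Lemma coef_symbol d P n : (symbol d P)`_n =
  \sum_(a <- msupp P) if (degZ a == d) && (n == a.2) then P@_a else 0.
Proof.
rewrite /symbol mmapE coef_sum; apply: eq_bigr => a _.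
rewrite coefCM; case: eqP => _ /=; last by rewrite coef0 mulr0.
by rewrite coefXn; case: eqP => _; rewrite ?mulr1 ?mulr0.
Qed.

Lemma symbol_coef P a : (symbol (degZ a) P)`_a.2 = P@_a.
Proof.
rewrite coef_symbol; under eq_bigr => b _.
  have -> : (degZ b == degZ a) && (a.2 == b.2) = (b == a).
    apply/andP/eqP => [[/eqP h /eqP h2]|->]; first exact: degZ_inj.
    by rewrite !eqxx.
  over.
case: msuppP => [aP|/[dup] aP ?]; last first.
  by rewrite big_seq big1 // => b bP; case: eqP => // ba; rewrite -ba bP in aP.
rewrite (big_fsetD1 a) //= eqxx big_seq big1 ?addr0 // => b.
by rewrite !inE => /andP[/negPf->].
Qed.

Lemma symbol_neq0_coef d P n : (symbol d P)`_n != 0 ->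
  exists2 a, degZ a = d /\ a.2 = n & P@_a != 0.
Proof.
move=> h; have : has (fun a => (degZ a == d) && (n == a.2)) (msupp P).
  apply: contraNT h; rewrite -all_predC => /allP h.
  rewrite coef_symbol big_seq big1 // => a /h /= /negPf -> //.
case/hasP => a aP /andP[/eqP da /eqP na]; exists a; first by [].
by rewrite mcoeff_neq0.
Qed.

(** A monomial of degree [d] and y-exponent [n] has x-index [(d - sigma l n) / rho], which must be
    an integer. The converse is [exists_homogeneous_symbol]. *)
Lemma coef_symbol_dvd d P (n : nat) : (symbol d P)`_n != 0 ->
  (rho %| d - sigma * l%:Z * n%:Z)%Z.
Proof.
case/symbol_neq0_coef => a [<- <-] _.
by rewrite /degZ addrK dvdz_mulr ?dvdzz.
Qed.

Lemma symbol_neq0_ex d P : symbol d P != 0 -> exists2 a, degZ a = d & P@_a != 0.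
Proof.
rewrite -lead_coef_eq0 lead_coefE => /symbol_neq0_coef[a [da _] Pa].
by exists a.
Qed.

Lemma degle_max P d a : degle P d -> P@_a != 0 -> degZ a <= d.
Proof. by move=> Pd; apply: contraNle => /Pd ->. Qed.

Lemma exists_lead P : P != 0 -> exists2 d, degle P d & symbol d P != 0.
Proof.
move=> P0; have [a0 a0P] : exists a, a \in msupp P.
  apply/fset0Pn; apply: contraNneq P0 => h; apply/eqP/malgP => a.
  by rewrite mcoeff0 mcoeff_outdom // h inE.
pose s : seq expo := msupp P; have a0s : a0 \in s by [].
have [a aP amax] : exists2 a, a \in s & {in s, forall b, degZ b <= degZ a}.
  move: s a0s; clear; move=> s; elim: s a0 => // x s IH a0 _.
  case: s IH => [|y s] IH; first by exists x; rewrite ?inE // => b; rewrite inE => /eqP->.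
  have [a aP amax] := IH y (mem_head _ _).
  have [xa|ax] := leP (degZ x) (degZ a).
    exists a; first by rewrite inE aP orbT.
    by move=> b; rewrite inE => /orP[/eqP->//|/amax].
  exists x; first by rewrite mem_head.
  move=> b; rewrite inE => /orP[/eqP->//|/amax ba]; exact: le_trans ba (ltW ax).
exists (degZ a).
  move=> b; apply: contraTeq; rewrite mcoeff_neq0 -leNgt; exact: amax.
apply: contraTneq aP => s0; rewrite -mcoeff_neq0 -symbol_coef s0 coef0.
by rewrite eqxx.
Qed.

Section Lead.
Variables (P : W K) (d : int).
Hypotheses (Pd : degle P d) (P0 : symbol d P != 0).

Lemma lead_vdeg : vdeg l rho sigma P = d%:~R / l%:R.
Proof.
have [a da Pa] := symbol_neq0_ex P0.
have aP : a \in (msupp P : seq expo) by rewrite -mcoeff_neq0.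
have hle b : b \in (msupp P : seq expo) -> degE l rho sigma b <= d%:~R / l%:R.
  rewrite -mcoeff_neq0 degE_degZ => /(degle_max Pd) h.
  by rewrite ler_pM2r ?invr_gt0 ?ltr0n // ler_int.
apply/eqP; rewrite eq_le; apply/andP; split.
  (* The starting value of the maximum is the degree of the head of the support, a genuine element
     because the support is nonempty. *)
  rewrite /vdeg big_seq; apply: (big_ind (fun x => x <= d%:~R / l%:R)).
  - apply: hle; case: (msupp P : seq expo) aP => //= x s _; exact: mem_head.
  - by move=> x y hx hy; rewrite ge_max hx hy.
  - by move=> b; apply: hle.
rewrite -da -degE_degZ /vdeg.
elim: (msupp P : seq expo) {hle} aP (degE _ _ _ (head _ _)) => // x s IH.
rewrite inE => /orP[/eqP <-|ha] z; rewrite big_cons le_max ?lexx //.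
by rewrite IH ?orbT.
Qed.

Lemma mcoeff_ell a :
  (ell l rho sigma P)@_a = if degZ a == d then P@_a else 0.
Proof.
have dE b : (degE l rho sigma b == vdeg l rho sigma P) = (degZ b == d).
  rewrite lead_vdeg degE_degZ (inj_eq (mulIf _)) ?eqr_int //.
  by rewrite invr_eq0 pnatr_eq0 -lt0n.
rewrite /ell /Psi raddf_sum /= (eq_bigl (fun b => degZ b == d)) //.
under eq_bigr do rewrite mcoeffU.
case: msuppP => [aP|/[dup] aP ?]; last first.
  rewrite if_same big_seq_cond big1 // => b /andP[bP _].
  by case: eqP => // ba; rewrite -ba bP in aP.
rewrite big_mkcond (big_fsetD1 a) //= eqxx mulr1n big_seq big1 ?addr0 // => b.
by rewrite !inE => /andP[/negPf-> _]; rewrite if_same.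
Qed.
End Lead.

(** * Products and powers *)

Lemma mcoeff_mulW P Q e : (mulW l P Q)@_e =
  \sum_(a <- msupp P) \sum_(b <- msupp Q) P@_a * Q@_b * (monmul K l a b)@_e.
Proof.
rewrite raddf_sum; apply: eq_bigr => a _ /=.
by rewrite raddf_sum; apply: eq_bigr => b _ /=; rewrite mcoeffZ.
Qed.

Lemma commWE P Q : commW l P Q =
  \sum_(a <- msupp P) \sum_(b <- msupp Q)
    (P@_a * Q@_b) *: (monmul K l a b - monmul K l b a).
Proof.
rewrite /commW /mulW [X in _ - X]exchange_big -sumrB; apply: eq_bigr => a _.
by rewrite -sumrB; apply: eq_bigr => b _; rewrite scalerBr [Q@_b * _]mulrC.
Qed.

Definition monexp (a b : expo) (m : nat) : expo :=
  (a.1 + b.1 - (m * l)%:Z, (a.2 + b.2 - m)%N).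

(** The bound on [m] makes the truncated subtraction in the y-exponent exact. *)
Lemma degZ_monexp a b m : (m <= a.2)%N ->
  degZ (monexp a b m) = degZ a + degZ b - m%:Z * wgt.
Proof.
move=> ma; rewrite /degZ /monexp /wgt /= -subzn ?PoszD ?PoszM; first by ring.
exact: leq_trans ma (leq_addr _ _).
Qed.

Lemma monmul_recl a b : monmul K l a b = << monexp a b 0 >> +
  \sum_(m < a.2) << ('C(a.2, m.+1)%:R * ffact (Defs.frac K l b.1) m.+1)
     *g monexp a b m.+1 >>.
Proof.
by rewrite /monmul big_ord_recl /= bin0 /ffact big_ord0 mulr1.
Qed.

Hypothesis Hw : 0 < wgt.

(** Only the term [m = 0] can reach degree [p + q], since the others lose a positive multiple of
    [wgt]. *)
Lemma symbol_monmul a b p q : degZ a <= p -> degZ b <= q ->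
  symbol (p + q) (monmul K l a b) =
  (if degZ a == p then 'X^(a.2) else 0) * (if degZ b == q then 'X^(b.2) else 0).
Proof.
move=> ap bq; rewrite monmul_recl symbolD symbol_sum big1 => [|m _]; last first.
  rewrite symbolU degZ_monexp // ifF ?mulr0 //; apply/negbTE.
  have := mulr_gt0 (isT : 0 < m.+1%:Z) Hw; lia.
rewrite addr0 symbolU mul1r degZ_monexp // mul0r subr0 /= subn0.
case: eqP => [e|e].
  have -> : degZ a = p by lia.
  have -> : degZ b = q by lia.
  by rewrite !eqxx exprD.
case: eqP => [ea|]; last by rewrite mul0r.
case: eqP => [eb|]; last by rewrite mulr0.
by rewrite ea eb in e.
Qed.

Lemma monmul_degle a b p q : degZ a <= p -> degZ b <= q ->
  degle (monmul K l a b) (p + q).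
Proof.
move=> ap bq e he; rewrite raddf_sum big1 //= => m _.
rewrite mcoeffU; case: eqP => // eE; move: he.
have ma : (m <= a.2)%N by rewrite -ltnS.
rewrite -eE -/(monexp a b m) degZ_monexp // => he; exfalso.
have := mulr_ge0 (le0z_nat m) (ltW Hw); lia.
Qed.

Lemma degle_mulW P Q p q : degle P p -> degle Q q -> degle (mulW l P Q) (p + q).
Proof.
move=> Pp Qq e he; rewrite mcoeff_mulW big1 // => a _; rewrite big1 // => b _.
have [ap|/Pp ->] := leP (degZ a) p; last by rewrite !mul0r.
have [bq|/Qq ->] := leP (degZ b) q; last by rewrite mulr0 mul0r.
by rewrite (monmul_degle ap bq he) mulr0.
Qed.

Lemma symbol_mulW P Q p q : degle P p -> degle Q q ->
  symbol (p + q) (mulW l P Q) = symbol p P * symbol q Q.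
Proof.
move=> Pp Qq; rewrite [mulW _ _ _]/mulW symbol_sum [symbol p P]mmapE mulr_suml.
apply: eq_bigr => a _; rewrite symbol_sum [symbol q Q]mmapE mulr_sumr.
apply: eq_bigr => b _; rewrite symbolZ.
have [ap|/Pp ->] := leP (degZ a) p; last by rewrite polyC0 !mul0r.
have [bq|/Qq ->] := leP (degZ b) q; last by rewrite mulr0 polyC0 !mul0r mulr0.
by rewrite symbol_monmul // polyCM mulrACA.
Qed.

Lemma degle_expW P p n : degle P p -> degle (expW l P n) (n%:Z * p).
Proof.
move=> Pp; elim: n => [|n IH].
  move=> e he; rewrite /expW /= /oneW mcoeffU; case: eqP => // ee.
  by move: he; rewrite -ee /degZ /= !mulr0 mul0r addr0 ltxx.
rewrite intS mulrDl mul1r; exact: degle_mulW.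
Qed.

Lemma symbol_expW P p n : degle P p ->
  symbol (n%:Z * p) (expW l P n) = symbol p P ^+ n.
Proof.
move=> Pp; elim: n => [|n IH].
  by rewrite mul0r /expW /= /oneW symbolU /degZ /= !mulr0 addr0 eqxx mulr1.
rewrite intS mulrDl mul1r exprS -IH; apply: symbol_mulW => //.
exact: degle_expW.
Qed.

(** * Degree drop of commutators *)

Lemma monmul_comm a b : monmul K l a b - monmul K l b a = 
  \sum_(m < a.2) << ('C(a.2, m.+1)%:R * ffact (Defs.frac K l b.1) m.+1)
     *g monexp a b m.+1 >> -
  \sum_(m < b.2) << ('C(b.2, m.+1)%:R * ffact (Defs.frac K l a.1) m.+1)
     *g monexp b a m.+1 >>.
Proof.
rewrite !monmul_recl; have -> : monexp b a 0 = monexp a b 0.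
  by rewrite /monexp (addrC b.1) (addnC b.2).
by rewrite opprD addrACA subrr add0r.
Qed.

(** The terms [m = 0] of the two products cancel, and every other term has lost at least [wgt]. *)
Lemma monmul_comm_degle a b p q : degZ a <= p -> degZ b <= q ->
  degle (monmul K l a b - monmul K l b a) (p + q - wgt).
Proof.
move=> ap bq e he; rewrite monmul_comm mcoeffB.
suff tail0 x y : degZ x + degZ y <= p + q -> (\sum_(m < x.2)
    << ('C(x.2, m.+1)%:R * ffact (Defs.frac K l y.1) m.+1)
     *g monexp x y m.+1 >>)@_e = 0.
  by rewrite !tail0 ?subrr //; lia.
move=> xy; rewrite raddf_sum big1 //= => m _; rewrite mcoeffU.
case: eqP => // eE; move: he; rewrite -eE degZ_monexp // => he; exfalso.
by have := mulr_ge0 (le0z_nat m) (ltW Hw); rewrite intS mulrDl in he; lia.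
Qed.

Lemma degle_commW P Q p q : degle P p -> degle Q q ->
  degle (commW l P Q) (p + q - wgt).
Proof.
move=> Pp Qq e he; rewrite commWE raddf_sum big1 //= => a _.
rewrite raddf_sum big1 //= => b _; rewrite mcoeffZ.
have [ap|/Pp ->] := leP (degZ a) p; last by rewrite !mul0r.
have [bq|/Qq ->] := leP (degZ b) q; last by rewrite mulr0 mul0r.
by rewrite (monmul_comm_degle ap bq he) mulr0.
Qed.

(** Only the first contraction reaches this degree. For [a.2 = 0] the coefficient vanishes, so the
    truncated predecessor does no harm. *)
Lemma symbol_monmul_tail a b p q : degZ a <= p -> degZ b <= q ->
  symbol (p + q - wgt) (\sum_(m < a.2)
    << ('C(a.2, m.+1)%:R * ffact (Defs.frac K l b.1) m.+1) *g monexp a b m.+1 >>) =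
  if (degZ a == p) && (degZ b == q) then
    (a.2%:R * Defs.frac K l b.1)%:P * 'X^((a.2 + b.2).-1) else 0.
Proof.
move=> ap bq; rewrite symbol_sum.
have -> : (degZ a == p) && (degZ b == q) = (degZ a + degZ b == p + q).
  by apply/andP/eqP => [[/eqP -> /eqP ->]//|h]; split; lia.
have deg_m (m : nat) : (m < a.2)%N -> (degZ (monexp a b m.+1) == p + q - wgt) =
    (degZ a + degZ b - m%:Z * wgt == p + q).
  by move=> ma; rewrite degZ_monexp // intS mulrDl; lia.
case: a ap deg_m => a1 [|n] ap deg_m; rewrite [(_, _).2]/=.
  by rewrite big_ord0 mul0r polyC0 mul0r if_same.
rewrite big_ord_recl big1 => [|m _]; last first.
  rewrite symbolU deg_m; last by rewrite ltnS ltn_ord.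
  rewrite ifF ?mulr0 //; apply/negbTE.
  have := mulr_gt0 (isT : 0 < (lift ord0 m)%:Z) Hw; lia.
rewrite addr0 symbolU deg_m // mul0r subr0 bin1 /ffact big_ord1 subr0.
by case: ifP => _; rewrite ?mulr0 //= subn1.
Qed.

(** * Leading forms, and realisation of polynomials as symbols *)

(** Up to the factor [l], the threshold in [commRS] is [p + q - wgt], which already bounds the
    commutator from above. Its degree is therefore below the threshold exactly when the symbol there
    vanishes. *)
Lemma commRSE P Q p q : degle P p -> symbol p P != 0 -> degle Q q -> symbol q Q != 0 ->
  commRS l rho sigma P Q = if symbol (p + q - wgt) (commW l P Q) == 0 then 0
    else ell l rho sigma (commW l P Q).
Proof.
move=> Pp P0 Qq Q0; rewrite /commRS (lead_vdeg Pp P0) (lead_vdeg Qq Q0).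
have Rd := degle_commW Pp Qq; set R := commW l P Q in Rd *.
have l0 : l%:R != 0 :> rat by rewrite pnatr_eq0 -lt0n.
have -> : p%:~R / l%:R + q%:~R / l%:R - (rho + sigma)%:~R = (p + q - wgt)%:~R / l%:R :> rat.
  rewrite /wgt !intrD intrN !intrM !intrD -!pmulrn; field; exact: l0.
have lp : 0 < l%:R^-1 :> rat by rewrite invr_gt0 ltr0n.
case: ifP => [/orP[/eqP ->|]|].
- by rewrite /symbol mmap0 eqxx.
- case: eqVneq => // s0; by rewrite (lead_vdeg Rd s0) ltxx.
- move/negbT; rewrite negb_or => /andP[R0].
  have [d Dd s0] := exists_lead R0; rewrite (lead_vdeg Dd s0) ltr_pM2r // ltr_int -leNgt.
  have [a da Ra] := symbol_neq0_ex s0.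
  have := degle_max Rd Ra; rewrite da => h1 h2.
  have -> : p + q - wgt = d by lia.
  by rewrite (negPf s0).
Qed.

Lemma ell_lead_eq P Q p q : degle P p -> symbol p P != 0 -> degle Q q -> symbol q Q != 0 ->
  ell l rho sigma P = ell l rho sigma Q -> p = q /\ symbol p P = symbol q Q.
Proof.
move=> Pp P0 Qq Q0 PQ.
have pq : p = q.
  have [a da Pa] := symbol_neq0_ex P0.
  have := mcoeff_ell Pp P0 a; rewrite PQ (mcoeff_ell Qq Q0) da eqxx.
  by case: eqP => // _ h; rewrite -h eqxx in Pa.
split=> //; rewrite -{q}pq in Qq Q0 *.
apply/polyP => n.
(* Only a nonzero coefficient comes from an actual monomial, so the comparison is made there and
   applied in both directions. *)
suff key R S : degle R p -> symbol p R != 0 -> degle S p -> symbol p S != 0 ->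
    ell l rho sigma R = ell l rho sigma S ->
    (symbol p R)`_n != 0 -> (symbol p R)`_n = (symbol p S)`_n.
  have [P0'|/(key P Q)] := eqVneq (symbol p P)`_n 0; last by apply.
  have [->//|/(key Q P)/esym] := eqVneq (symbol p Q)`_n 0; by apply.
move=> Rp R0 Sp S0 RS /symbol_neq0_coef [a [da an] _].
have := congr1 (mcoeff a) RS; rewrite (mcoeff_ell Rp R0) (mcoeff_ell Sp S0) da eqxx.
by rewrite -an -da !symbol_coef.
Qed.

Lemma ell_scale P Q d c : degle P d -> degle Q d -> symbol d Q != 0 -> c != 0 ->
  symbol d P = c%:P * symbol d Q -> ell l rho sigma P = c *: ell l rho sigma Q.
Proof.
move=> Pd Qd Q0 c0 PQ.
have P0 : symbol d P != 0 by rewrite PQ mulf_neq0 ?polyC_eq0.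
apply/malgP => a; rewrite mcoeffZ (mcoeff_ell Pd P0) (mcoeff_ell Qd Q0).
case: eqP => da; last by rewrite mulr0.
by rewrite -!symbol_coef da PQ coefCM.
Qed.

(* Split h into the part with admissible exponents and the rest: multiplication
   by f keeps the exponents of the two parts disjoint, so f kills the rest. *)
Lemma symbol_factor_dvd P d e (f h : {poly K}) : symbol (d + e) P = h * f -> f != 0 ->
  (forall n : nat, f`_n != 0 -> (rho %| e - sigma * l%:Z * n%:Z)%Z) ->
  forall n : nat, h`_n != 0 -> (rho %| d - sigma * l%:Z * n%:Z)%Z.
Proof.
move=> PE f0 Hf.
pose S (n : nat) := (rho %| d - sigma * l%:Z * n%:Z)%Z.
pose h2 := \poly_(n < size h) if S n then 0 else h`_n.
have h2E n : h2`_n = if S n then 0 else h`_n.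
  rewrite coef_poly; case: ltnP => // hn.
  by rewrite (nth_default _ hn) if_same.
suff h20 : h2 = 0.
  move=> n; have := h2E n; rewrite h20 coef0 /S.
  by case: ifP => // _ <-; rewrite eqxx.
suff : h2 * f = 0 by move/eqP; rewrite mulf_eq0 (negPf f0) orbF => /eqP.
have sum_dvd (n i : nat) : (i <= n)%N -> f`_(n - i) != 0 ->
    (rho %| d + e - sigma * l%:Z * n%:Z)%Z = S i.
  move=> le /Hf fn; rewrite /S; have -> : d + e - sigma * l%:Z * n%:Z =
     (d - sigma * l%:Z * i%:Z) + (e - sigma * l%:Z * (n - i)%N%:Z).
    by rewrite -subzn //; ring.
  by rewrite rpredDr.
apply/polyP => n; rewrite coef0 coefM.
have [Sn|Sn] := boolP (rho %| d + e - sigma * l%:Z * n%:Z)%Z.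
  rewrite big1 // => i _; have [->|fi] := eqVneq f`_(n - i) 0; first by rewrite mulr0.
  by rewrite h2E -(sum_dvd n) // ?Sn ?mul0r // -ltnS.
transitivity ((h * f)`_n); last first.
  by rewrite -PE; apply/eqP; apply: contraNT Sn => /coef_symbol_dvd.
rewrite coefM; apply: eq_bigr => i _.
have [->|fi] := eqVneq f`_(n - i) 0; first by rewrite !mulr0.
by rewrite h2E -(sum_dvd n) // ?(negPf Sn) // -ltnS.
Qed.

(** [E] has one monomial per exponent of [h], with x-index obtained by dividing by [rho]; wherever
    the division is inexact the coefficient is zero. *)
Lemma exists_homogeneous_symbol d (h : {poly K}) : h != 0 ->
  (forall n : nat, h`_n != 0 -> (rho %| d - sigma * l%:Z * n%:Z)%Z) ->
  exists E : W K, [/\ degle E d, symbol d E = h & homogeneous l rho sigma E].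
Proof.
move=> h0 Hh.
pose ex (n : nat) : expo := (((d - sigma * l%:Z * n%:Z) %/ rho)%Z, n).
pose E : W K := \sum_(n < size h) << h`_n *g ex n >>.
have deg_ex n : h`_n != 0 -> degZ (ex n) = d.
  move/Hh => hn; rewrite /degZ /ex /= mulrC divzK //; ring.
have Ea a : degZ a <> d -> E@_a = 0.
  move=> da; rewrite raddf_sum big1 //= => n _; rewrite mcoeffU.
  have [->|/deg_ex dn] := eqVneq h`_n 0; first by rewrite mul0rn.
  by case: eqP => // ea; rewrite -ea in da.
have Ed : degle E d by move=> a ad; apply: Ea => da; rewrite da ltxx in ad.
have Es : symbol d E = h.
  rewrite symbol_sum -[RHS]coefK poly_def; apply: eq_bigr => n _.
  rewrite symbolU mul_polyC; have [->|/deg_ex ->] := eqVneq h`_n 0; first by rewrite !scale0r.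
  by rewrite eqxx.
exists E; split=> //; right; apply/malgP => a; rewrite /Psi (mcoeff_ell Ed) ?Es //.
by case: eqP => // /Ea.
Qed.

(** * The symbol of a commutator as a Poisson bracket *)

Hypothesis Kl : l%:R != 0 :> K.

(** The first contractions give the coefficient [(a.2 b.1 - b.2 a.1) / l]. Multiplying by [rho l]
    and using [rho a.1 = p - sigma l a.2], and likewise for [b], cancels the [sigma] terms and
    leaves [q a.2 - p b.2]. *)
Lemma symbol_monmul_comm a b p q : degZ a <= p -> degZ b <= q ->
  let A : {poly K} := if degZ a == p then 'X^(a.2) else 0 in
  let B : {poly K} := if degZ b == q then 'X^(b.2) else 0 in
  (rho * l%:Z)%:~R%:P * symbol (p + q - wgt) (monmul K l a b - monmul K l b a) =
  q%:~R%:P * A^`() * B - p%:~R%:P * A * B^`().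
Proof.
move=> ap bq /=; rewrite monmul_comm symbolB symbol_monmul_tail //.
rewrite [p + q]addrC symbol_monmul_tail // andbC.
case: (eqVneq (degZ b) q) => [eb|_]; last by rewrite deriv0 !mulr0 !subr0 mulr0.
case: (eqVneq (degZ a) p) => [ea|_]; last by rewrite deriv0 !mulr0 !mul0r !subr0 mulr0.
rewrite /= [(b.2 + a.2)%N]addnC -mulrBl mulrA !derivXn.
have -> : q%:~R%:P * ('X^(a.2.-1) *+ a.2) * 'X^(b.2) =
    (q%:~R * a.2%:R)%:P * 'X^((a.2 + b.2).-1) :> {poly K}.
  case: (a.2) => [|n]; first by rewrite mulr0n !mulr0 mul0r polyC0 mul0r.
  by rewrite addSn /= exprD -mulr_natl polyCM polyCMn; ring.
have -> : p%:~R%:P * 'X^(a.2) * ('X^(b.2.-1) *+ b.2) =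
    (p%:~R * b.2%:R)%:P * 'X^((a.2 + b.2).-1) :> {poly K}.
  case: (b.2) => [|n]; first by rewrite mulr0n !mulr0 polyC0 mul0r.
  by rewrite addnS /= exprD -mulr_natl polyCM polyCMn; ring.
rewrite -mulrBl; congr (_ * _); rewrite -!polyCB -polyCM; congr polyC.
rewrite -ea -eb /degZ /Defs.frac !intrD !intrM -!pmulrn; field.
exact: Kl.
Qed.

Lemma symbol_commW P Q p q : degle P p -> degle Q q ->
  (rho * l%:Z)%:~R%:P * symbol (p + q - wgt) (commW l P Q) =
  q%:~R%:P * (symbol p P)^`() * symbol q Q - p%:~R%:P * symbol p P * (symbol q Q)^`().
Proof.
move=> Pp Qq; rewrite commWE symbol_sum [symbol p P]mmapE [symbol q Q]mmapE.
rewrite !raddf_sum /= -!mulrA !big_distrlr /= !mulr_sumr -sumrB; apply: eq_bigr => a _.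
rewrite symbol_sum !mulr_sumr -sumrB; apply: eq_bigr => b _; rewrite symbolZ.
rewrite !derivM !derivC !mul0r !add0r.
have [ap|/Pp ->] := leP (degZ a) p; last by rewrite !(mul0r, polyC0, mulr0, subr0).
have [bq|/Qq ->] := leP (degZ b) q; last by rewrite !(mul0r, polyC0, mulr0, subr0).
have /= := symbol_monmul_comm ap bq; rewrite polyCM.
move: (symbol _ _) (if _ then _ else _) (if _ then _ else _) => s A B h.
by rewrite mulrCA h; ring.
Qed.

End Symbols.

(** * Reduction of the bracket equation and construction of [E] *)

(** Differentiating the factor [f ^+ j] produces exactly the [j v] term of the first coefficient;
    what remains has the common factor [f ^+ j]. *)
Lemma bracket_eq_expr_cancel (F : fieldType) (f h : {poly F}) (v w : int) (lam : F) (j : nat) :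
  f != 0 ->
  (j%:Z * v + w)%:~R%:P * f^`() * (h * f ^+ j) - v%:~R%:P * f * (h * f ^+ j)^`() =
    lam%:P * f ^+ j.+1 ->
  w%:~R%:P * f^`() * h - v%:~R%:P * f * h^`() = lam%:P * f.
Proof.
move=> f0 eqn; apply: (mulIf (expf_neq0 j f0)).
have fj := mul_derivX f j.
transitivity (lam%:P * f ^+ j.+1); last by rewrite exprS mulrA.
rewrite -eqn derivM intrD intrM -pmulrn polyCD polyCM.
move: (f ^+ j)^`() fj => df fj.
transitivity ((j%:R%:P * v%:~R%:P + w%:~R%:P) * f^`() * (h * f ^+ j) -
   v%:~R%:P * (f * h^`() * f ^+ j + h * (f * df))); last by ring.
by rewrite fj; ring.
Qed.

Lemma bracket_expr (F : fieldType) (f g : {poly F}) (v q : int) (t : nat) : (0 < t)%N ->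
  q%:~R%:P * (f ^+ t)^`() * g - (t%:Z * v)%:~R%:P * f ^+ t * g^`() =
  t%:R%:P * f ^+ t.-1 * (q%:~R%:P * f^`() * g - v%:~R%:P * f * g^`()).
Proof.
case: t => // t _; rewrite deriv_exp intrM -pmulrn polyCM -mulr_natl polyCMn exprS /=.
by ring.
Qed.

Theorem theorem2p15 (K : fieldType) (HK : [pchar K] =i pred0) (l : nat)
  (Hl : (0 < l)%N) (rho sigma : int) (HV : inV rho sigma) (Hsig : sigma <= 0)
  (C D : W K) (HC : C != 0) (HD : D != 0) (HvC : 0 < vdeg l rho sigma C)
  (k j : nat) (Hk : (0 < k)%N)
  (Hkj : commRS l rho sigma (expW l C k) D = ell l rho sigma (expW l C (k + j))) :
  exists E : W K, homogeneous l rho sigma E /\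
    forall t : nat, (0 < t)%N ->
      commRS l rho sigma (expW l C t) E = t%:R *: ell l rho sigma (expW l C t).
Proof.
have [_ rs0] := HV.
(* Positivity of [rho] is where [sigma <= 0] enters; it lets degree and y-exponent determine the
   x-exponent. *)
have Hrho : 0 < rho by lia.
pose w := wgt l rho sigma.
have Hw : 0 < w by rewrite mulr_gt0.
have natK n : (0 < n)%N -> n%:R != 0 :> K.
  by move=> n0; rewrite ((pcharf0P K).1 HK) -lt0n.
have [v Cv f0] := exists_lead l sigma Hrho HC.
have [q Dq g0] := exists_lead l sigma Hrho HD.
have v0 : 0 < v.
  by move: HvC; rewrite (lead_vdeg Hl Cv f0) pmulr_lgt0 ?invr_gt0 ?ltr0n // ltr0z.
have Ct t := degle_expW (n := t) Hl Hrho Hw Cv.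
have sCt t := symbol_expW Hl Hrho Hw t Cv.
set f := symbol l rho sigma v C in f0 sCt *.
set g := symbol l rho sigma q D in g0 *.
have ft0 t : symbol l rho sigma (t%:Z * v) (expW l C t) != 0 by rewrite sCt expf_neq0.
(* Comparing degrees in the hypothesis gives [k v + q - w = (k + j) v]. In the constant, [rho l]
   comes from [symbol_commW] and [1 / k] from the derivative of [f ^+ k]. *)
have [qE fg] : q = j%:Z * v + w /\
    q%:~R%:P * f^`() * g - v%:~R%:P * f * g^`() = ((rho * l%:Z)%:~R / k%:R)%:P * f ^+ j.+1.
  have := commRSE Hl Hrho Hw (Ct k) (ft0 k) Dq g0; rewrite Hkj.
  case: eqVneq => [_ e0|R0 RE].
    (* A zero bracket is impossible, because the leading form of [C^(k+j)] is nonzero. *)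
    have [a da] := symbol_neq0_ex (ft0 (k + j)%N).
    have := mcoeff_ell Hl (Ct (k + j)%N) (ft0 (k + j)%N) a.
    by rewrite e0 mcoeff0 da eqxx => <-; rewrite eqxx.
  have Rd := degle_commW Hl Hrho Hw (Ct k) Dq.
  have [dE sE] := ell_lead_eq Hl Hrho (Ct (k + j)%N) (ft0 (k + j)%N) Rd R0 RE.
  split; first by move: dE; rewrite PoszD mulrDl -/w; lia.
  have := symbol_commW Hl Hrho Hw (natK l Hl) (Ct k) Dq.
  rewrite -sE !sCt bracket_expr //; set br := _ - _ => eqn.
  have /(mulfI (expf_neq0 k.-1 f0)) h : f ^+ k.-1 * (k%:R%:P * br) =
      f ^+ k.-1 * ((rho * l%:Z)%:~R%:P * f ^+ j.+1).
    rewrite mulrCA mulrA -eqn mulrCA -exprD; congr (_ * f ^+ _); lia.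
  have kP : k%:R%:P != 0 :> {poly K} by rewrite polyC_eq0 natK.
  apply: (mulfI kP); rewrite h mulrA -polyCM mulrCA divff ?mulr1 ?natK //.
rewrite qE in fg Dq g0 *.
have /dvdpP[h gE] := bracket_eq_expr_dvd HK v0 Hw f0 fg.
rewrite gE in fg; have {}fg := bracket_eq_expr_cancel f0 fg.
have h0 : h != 0 by apply: contraNneq g0; rewrite gE => ->; rewrite mul0r.
(* [h] is the quotient of a symbol of degree [j v + w] by one of degree [j v], so its exponents are
   admissible for degree [w]. *)
have hS := @symbol_factor_dvd K l rho sigma D w (j%:Z * v) (f ^+ j) h.
(* [h] solves the reduced equation with constant [rho l / k]; the factor [k] normalises this to
   [rho l]. *)
have [||E [Ew Es Eh]] := @exists_homogeneous_symbol K l rho sigma Hl w (k%:R *: h).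
- by rewrite scaler_eq0 negb_or h0 natK.
- move=> n; rewrite coefZ mulf_eq0 negb_or => /andP[_]; apply: hS.
  + by rewrite addrC -gE /g qE.
  + exact: expf_neq0.
  + by move=> m; rewrite -sCt; apply: coef_symbol_dvd.
have E0 : symbol l rho sigma w E != 0 by rewrite Es scaler_eq0 negb_or h0 natK.
exists E; split=> // t t0.
have := symbol_commW Hl Hrho Hw (natK l Hl) (Ct t) Ew.
have := degle_commW Hl Hrho Hw (Ct t) Ew.
have := commRSE Hl Hrho Hw (Ct t) (ft0 t) Ew E0.
rewrite -/w addrK; set R := commW _ _ _ => RE Rd.
rewrite sCt bracket_expr // Es derivZ => sR.
have {}sR : symbol l rho sigma (t%:Z * v) R = t%:R%:P * f ^+ t.
  have rl0 : (rho * l%:Z)%:~R%:P != 0 :> {poly K}.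
    by rewrite polyC_eq0 pchar0_intr_eq0 //; nia.
  apply: (mulfI rl0); rewrite sR -!mul_polyC.
  have -> : w%:~R%:P * f^`() * (k%:R%:P * h) - v%:~R%:P * f * (k%:R%:P * h^`()) =
    k%:R%:P * (w%:~R%:P * f^`() * h - v%:~R%:P * f * h^`()) by ring.
  rewrite fg [k%:R%:P * _]mulrA -polyCM [k%:R * _]mulrCA divff ?natK // mulr1.
  by case: t t0 {RE Rd sR} R => // t _ _; rewrite exprS /=; ring.
(* The symbol [t f^t] is nonzero in characteristic zero, so the bracket is the leading form of the
   commutator. *)
rewrite RE sR ifF; last by apply/negbTE; rewrite mulf_neq0 ?expf_neq0 ?polyC_eq0 ?natK.
by apply: (ell_scale Hl Hrho Rd (Ct t) (ft0 t)); rewrite ?natK // sCt.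
Qed.
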